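(* Let $V=\bigoplus_{m=0}^{\infty}V_m$ be a $C_2$-cofinite vertex operator algebra and let $A\subseteq V$ be a set of homogeneous elements such that $V=C_2(V)+\langle A\rangle$. Let $W$ be a weak $V$-module generated by an element $w\in W$. Then $W$ is spanned by the elements $$ \{\, v^1(i_1)\cdots v^k(i_k)w \ \mid\ k\ge 0,\ v^j\in A,\ i_1<\cdots<i_k \,\}.$$ In particular, if for $m\in\mathbb Z$ one sets $$\mathcal W(m)=\left\langle v^1(i_1)\cdots v^k(i_k)w \ \mid\ v^j\in V \text{ homogeneous},\ \deg(v^1(i_1)\cdots v^k(i_k))=m\right\rangle ,$$ then $\mathcal W(m)=0$ for all sufficiently negative $m$ (i.e. for $m\ll 0$).
   Context: $V=\bigoplus_{m\ge 0}V_m$ is a vertex operator algebra over $\mathbb C$ (no negative weights, each $V_m$ finite dimensional); for $v\in V$ write $Y(v,z)=\sum_{n\in\mathbb Z}v(n)z^{-n-1}$, and $\mathrm{wt}(v)=|v|$ for the weight of a homogeneous $v$. Angle brackets $\langle\cdot\rangle$ denote linear span over $\mathbb C$. $C_2(V)=\langle a(-2)b\mid a,b\in V\rangle$, and $V$ is called $C_2$-cofinite if $\dim V/C_2(V)<\infty$. A weak $V$-module is a vector space $W$ with a vertex operator map $v\mapsto Y^W(v,z)=\sum_n v(n)z^{-n-1}\in \mathrm{End}(W)[[z,z^{-1}]]$ satisfying lower truncation ($v(n)w=0$ for $n\gg0$), $Y^W(\mathbf 1,z)=1$, the Virasoro relations and $L(-1)$-derivative property, and the commutator and associativity formulas; no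 grading is assumed. ''$W$ is generated by $w$'' means generated under the action of all modes $v(n)$. For homogeneous $v$ the operator $v(i)$ has degree $\deg v(i)=\mathrm{wt}(v)-i-1$, and degrees are additive: $\deg(v^1(i_1)\cdots v^k(i_k))=\sum_j(\mathrm{wt}(v^j)-i_j-1)$. *)

(* Defs.v *)
From HB Require Import structures.
From mathcomp Require Import all_boot all_order all_algebra.
From mathcomp Require Import complex.
From mathcomp Require Import boolp classical_sets reals.

Set Implicit Arguments.
Unset Strict Implicit.
Unset Printing Implicit Defensive.

Import GRing.Theory.

Local Open Scope classical_set_scope.
Local Open Scope ring_scope.

Definition lspan (F : fieldType) (V : lmodType F) (S : set V) : set V :=
  [set x | exists2 s : seq (F * V),
     (forall p, p \in s -> S p.2) & x = \sum_(p <- s) p.1 *: p.2].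

Definition fin_dim (F : fieldType) (V : lmodType F) (U : set V) : Prop :=
  exists s : seq V, U = lspan [set` s].

(* The quotient of V by U is finite dimensional: the classes of finitely many
   vectors span it. *)
Definition fin_codim (F : fieldType) (V : lmodType F) (U : set V) : Prop :=
  exists s : seq V, forall v, exists2 x, lspan [set` s] x & U (v - x).

(* binz n j = n (n - 1) ... (n - j + 1) / j! for an arbitrary integer n. *)
Definition binz (F : fieldType) (n : int) (j : nat) : F :=
  (\prod_(i < j) (n - i%:Z)%:~R) / (j`!)%:R.

(* sums_to f s: all but finitely many f j vanish and the f j add up to s
   (the partial sums are eventually constant exactly in this case). The
   infinite sums in the identities below are all of this kind, by lower
   truncation. *)
Definition sums_to (F : fieldType) (W : lmodType F) (f : nat -> W) (s : W) :
    Prop :=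
  exists N : nat, forall n : nat, (N <= n)%N -> \sum_(j < n) f j = s.

(* Y v n is the mode v(n), the coefficient of z^(-n-1) in Y(v,z); and
   L(n) = omega(n+1). *)
Definition virasoro_relations (F : fieldType) (V W : lmodType F)
    (Y : V -> int -> {linear W -> W}) (omega : V) (c : F) : Prop :=
  let L (n : int) := Y omega (n + 1) in
  forall (m n : int) (x : W),
    L m (L n x) - L n (L m x) =
      (m - n)%:~R *: L (m + n) x
      + ((m + n == 0)%:R * ((m ^+ 3 - m)%:~R / 12%:R) * c) *: x.

(* The Jacobi identity is stated in its component form (Borcherds identity):
   sum_j C(p,j) (u(r+j)v)(p+q-j)
   = sum_j (-1)^j C(r,j) (u(p+r-j) v(q+j) - (-1)^r v(q+r-j) u(p+j)). *)
Record voa (F : fieldType) := Voa {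
  voa_space :> lmodType F;
  mode : voa_space -> int -> {linear voa_space -> voa_space};
  vacuum : voa_space;
  conformal : voa_space;
  central_charge : F;
  weight : nat -> set voa_space;
  weight_fin_dim : forall n, fin_dim (weight n);
  weight_sum : forall v : voa_space, exists (n : nat) (f : nat -> voa_space),
    (forall i, weight i (f i)) /\ v = \sum_(i < n) f i;
  weight_direct : forall (n : nat) (f : nat -> voa_space),
    (forall i, weight i (f i)) -> \sum_(i < n) f i = 0 ->
    forall i, (i < n)%N -> f i = 0;
  mode_linear : forall (n : int) (x : voa_space),
    linear (fun v : voa_space => mode v n x);
  mode_truncation : forall u v : voa_space,
    exists N : int, forall n : int, N <= n -> mode u n v = 0;
  vacuum_weight : weight 0%N vacuum;
  mode_vacuum : forall (n : int) (x : voa_space),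
    mode vacuum n x = if n == -1 then x else 0;
  creation : forall v : voa_space, mode v (-1) vacuum = v;
  creation_pos : forall (v : voa_space) (n : int),
    0 <= n -> mode v n vacuum = 0;
  jacobi : forall (p q r : int) (u v x : voa_space), exists s : voa_space,
    sums_to (fun j => binz F p j
      *: mode (mode u (r + j%:Z) v) (p + q - j%:Z) x) s /\
    sums_to (fun j => ((-1) ^+ j * binz F r j)
      *: (mode u (p + r - j%:Z) (mode v (q + j%:Z) x)
          - (-1) ^ r *: mode v (q + r - j%:Z) (mode u (p + j%:Z) x))) s;
  conformal_weight : weight 2%N conformal;
  mode_virasoro : virasoro_relations mode conformal central_charge;
  L0_weight : forall (n : nat) (v : voa_space),
    weight n v -> mode conformal 1 v = n%:R *: v;
  mode_derivative : forall (v : voa_space) (n : int) (x : voa_space),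
    mode (mode conformal 0 v) n x = - (n%:~R *: mode v (n - 1) x)
}.

Arguments mode {F} v _ _ : rename.
Arguments vacuum {F} v : rename.
Arguments conformal {F} v : rename.
Arguments central_charge {F} v : rename.
Arguments weight {F} v _ : rename.

Record weak_module (F : fieldType) (V : voa F) := WeakModule {
  module_space :> lmodType F;
  act : V -> int -> {linear module_space -> module_space};
  act_linear : forall (n : int) (x : module_space),
    linear (fun v : V => act v n x);
  act_truncation : forall (v : V) (x : module_space),
    exists N : int, forall n : int, N <= n -> act v n x = 0;
  act_vacuum : forall (n : int) (x : module_space),
    act (vacuum V) n x = if n == -1 then x else 0;
  act_virasoro : virasoro_relations act (conformal V) (central_charge V);
  act_derivative : forall (v : V) (n : int) (x : module_space),
    act (mode V (conformal V) 0 v) n x = - (n%:~R *: act v (n - 1) x);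
  (* [u(m), v(n)] = sum_j C(m,j) (u(j)v)(m+n-j) *)
  act_commutator : forall (u v : V) (m n : int) (x : module_space),
    sums_to (fun j => binz F m j
      *: act (mode V u j%:Z v) (m + n - j%:Z) x)
      (act u m (act v n x) - act v n (act u m x));
  (* (u(m)v)(n)
     = sum_j (-1)^j C(m,j) (u(m-j) v(n+j) - (-1)^m v(m+n-j) u(j)) *)
  act_associativity : forall (u v : V) (m n : int) (x : module_space),
    sums_to (fun j => ((-1) ^+ j * binz F m j)
      *: (act u (m - j%:Z) (act v (n + j%:Z) x)
          - (-1) ^ m *: act v (m + n - j%:Z) (act u j%:Z x)))
      (act (mode V u m v) n x)
}.

Arguments act {F V} w _ _ : rename.

Definition homogeneous (F : fieldType) (V : voa F) : set V :=
  [set v | exists n, weight V n v].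
Arguments homogeneous {F} V : rename.

Definition C2 (F : fieldType) (V : voa F) : set V :=
  lspan [set x : V | exists a b : V, x = mode V a (-2) b].
Arguments C2 {F} V : rename.

Definition C2_cofinite (F : fieldType) (V : voa F) : Prop :=
  fin_codim (C2 V).

(* W is the only subspace of W that contains w and is stable under all modes. *)
Definition generated_by (F : fieldType) (V : voa F) (W : weak_module V)
    (w : W) : Prop :=
  forall U : set W,
    GRing.submod_closed [in U] ->
    (forall (v : V) (n : int) (x : W), U x -> U (act W v n x)) ->
    U w -> U = [set: W].

(* monomial W [:: (v1, i1); ...; (vk, ik)] w = v1(i1) ... vk(ik) w. *)
Definition monomial (F : fieldType) (V : voa F) (W : weak_module V)
    (s : seq (V * int)) (w : W) : W :=
  foldr (fun p x => act W p.1 p.2 x) w s.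

(* monomial_degree s m: all vectors occurring in s are homogeneous and m is the
   sum of the wt(v) - i - 1 over the pairs (v, i) of s. This is a relation
   because the zero vector has every weight. *)
Inductive monomial_degree (F : fieldType) (V : voa F) :
    seq (V * int) -> int -> Prop :=
| MonomialDegreeNil : monomial_degree [::] 0
| MonomialDegreeCons (v : V) (n : nat) (i : int) (s : seq (V * int)) (m : int) :
    weight V n v -> monomial_degree s m ->
    monomial_degree ((v, i) :: s) (n%:Z - i - 1 + m).

Definition degree_space (F : fieldType) (V : voa F) (W : weak_module V)
    (w : W) (m : int) : set W :=
  lspan [set x : W | exists2 s : seq (V * int),
    monomial_degree s m & x = monomial s w].

(* Main.v *)
Require Import Defs.
From HB Require Import structures.
From mathcomp Require Import all_boot all_order all_algebra.
From mathcomp Require Import complex.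
From mathcomp Require Import boolp classical_sets reals.
From mathcomp Require Import zify ring.

Set Implicit Arguments.
Unset Strict Implicit.
Unset Printing Implicit Defensive.

Import Order.TTheory GRing.Theory Num.Theory.

Local Open Scope classical_set_scope.
Local Open Scope ring_scope.

(** A vector is a combination of words v^1(i_1)...v^k(i_k)w in homogeneous
letters. Filter the words by their total weight, the sum of the wt(v^j). Two
facts about this filtration do most of the work. A commutator [u(m), v(n)] is a
sum of modes of the u(j)v with j >= 0, whose weight is at most
wt(u) + wt(v) - 1, so modulo lower total weight the letters of a word commute
([reduces_swap]). By associativity a mode of a(-2)b is a sum of products of a
mode of a and a mode of b, of total weight one less, so modulo lower total
weight the elements of C_2(V) act as zero ([reduces_C2]). Since the weights are
bounded below by 0, induction on the total weight applies, and inside it every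
letter may be taken in the set A of generators of V modulo C_2(V)
([reduces_to_over]), which cofiniteness allows to be finite
([C2_generated_finite]).

It remains to separate repeated modes. The expansion of (u(-1)v)(2m+1)
contains u(m)v(m), or v(m)u(m), exactly once, and all its other terms are
products of modes a and b with a + b = 2m and a <> m ([repeated_mode]). The left
side is a single letter of weight wt(u) + wt(v): it leaves the total weight
unchanged and shortens the word. The other terms keep total weight, length and
the sum of the modes, but their modes are further apart. Because A is finite
there is a bound N beyond which all modes of elements of A kill w; a word with a
larger mode can be permuted so that this mode acts first, and is then zero
modulo lower total weight. For modes at most N with a given sum, spreading them
apart must stop ([spread_le_depth2]). So the induction runs on the total weight,
then on the length, then on the room left for spreading ([reduces_over]), and
ends at words whose modes are distinct, which can be sorted.

All the rewriting steps preserve the degree. A word of the final form has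
distinct modes, at most N, so only finitely many of its letters have negative
degree and its degree is bounded below ([normal_degree_ge]); this is the second
assertion. *)

(** * Linear spans *)

Definition subspace (F : fieldType) (V : lmodType F) (U : set V) : Prop :=
  U 0 /\ forall (c : F) (x y : V), U x -> U y -> U (c *: x + y).

Section Subspaces.
Variables (F : fieldType) (V : lmodType F).
Implicit Types (S U : set V) (x y : V).

Lemma subspaceD U x y : subspace U -> U x -> U y -> U (x + y).
Proof. by move=> [_ hU] Ux Uy; rewrite -[x]scale1r; apply: hU. Qed.

Lemma subspaceZ U c x : subspace U -> U x -> U (c *: x).
Proof. by move=> [U0 hU] Ux; rewrite -[_ *: _]addr0; apply: hU. Qed.

Lemma subspaceB U x y : subspace U -> U x -> U y -> U (x - y).
Proof.
by move=> hU Ux Uy; rewrite -scaleN1r; apply: subspaceD => //; apply: subspaceZ.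
Qed.

Lemma subspace_sum U (I : Type) (r : seq I) (P : pred I) (f : I -> V) :
  subspace U -> (forall i, P i -> U (f i)) -> U (\sum_(i <- r | P i) f i).
Proof.
move=> hU hf; apply: big_ind => //; first by case: hU.
by move=> x y; apply: subspaceD.
Qed.

Lemma subspaceZ_inv U c x : subspace U -> c != 0 -> U (c *: x) -> U x.
Proof. by move=> hU c0 Ux; rewrite -(scalerK c0 x); apply: subspaceZ. Qed.

Lemma subspace_set1_0 : subspace [set (0 : V)].
Proof. by split=> // c x y -> ->; rewrite scaler0 addr0. Qed.

Lemma subspace_lspan S : subspace (lspan S).
Proof.
split; first by exists [::]; rewrite ?big_nil.
move=> c _ _ [s hs ->] [t ht ->].
exists ([seq (c * p.1, p.2) | p <- s] ++ t); last first.
  rewrite big_cat big_map scaler_sumr /=; congr (_ + _).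
  by apply: eq_bigr => p _; rewrite scalerA.
by move=> p; rewrite mem_cat => /orP[/mapP[q qs ->]|/ht //]; exact: (hs q).
Qed.

Lemma lspan_gen S x : S x -> lspan S x.
Proof.
by move=> Sx; exists [:: (1, x)]; [move=> p; rewrite inE => /eqP->|
  rewrite big_seq1 scale1r].
Qed.

Lemma lspan_min S U : subspace U -> S `<=` U -> lspan S `<=` U.
Proof.
move=> hU SU _ [s hs ->]; rewrite big_seq.
by apply: subspace_sum => // p /hs /SU; apply: subspaceZ.
Qed.

Lemma lspan_mono S S' : S `<=` S' -> lspan S `<=` lspan S'.
Proof.
move=> SS'; apply: lspan_min; first exact: subspace_lspan.
by move=> x /SS' /lspan_gen.
Qed.

End Subspaces.

Lemma linear_scale (F : fieldType) (V W : lmodType F) (f : V -> W) c x :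
  linear f -> f (c *: x) = c *: f x.
Proof.
move=> lf; have f0 : f 0 = 0.
  by move: (lf 1 0 0); rewrite scaler0 addr0 scale1r -[LHS]addr0 => /addrI.
by rewrite -[c *: x]addr0 lf f0 addr0.
Qed.

Lemma subspace_preimage (F : fieldType) (V W : lmodType F) (f : V -> W)
    (U : set W) :
  linear f -> subspace U -> subspace (f @^-1` U).
Proof.
move=> lf [U0 hU]; split=> [|c x y Ux Uy].
  by rewrite /preimage /= -(scale0r 0) linear_scale // scale0r.
by rewrite /preimage /= lf; apply: hU.
Qed.

Lemma lspan_linear (F : fieldType) (V W : lmodType F) (f : V -> W)
    (S : set V) (U : set W) :
  linear f -> subspace U -> (forall x, S x -> U (f x)) ->
  forall x, lspan S x -> U (f x).
Proof.
by move=> lf hU h; apply: (lspan_min (subspace_preimage lf hU)).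
Qed.

(** * Finite sums and weights *)

Lemma sums_to_trunc (F : fieldType) (W : lmodType F) (f : nat -> W) s
    (K : nat) :
  sums_to f s -> (forall j, (K <= j)%N -> f j = 0) -> s = \sum_(j < K) f j.
Proof.
move=> [N hN] f0; rewrite -(hN (maxn K N)) ?leq_maxr // -!(big_mkord xpredT).
rewrite (@big_cat_nat _ _ _ K) ?leq_maxl //=.
rewrite [X in _ + X]big_nat_cond [X in _ + X]big1 ?addr0 //.
by move=> i /andP[/andP[/f0]].
Qed.

Lemma binz_small (F : fieldType) (m j : nat) : (m < j)%N -> binz F m j = 0.
Proof.
by move=> mj; rewrite /binz (bigD1 (Ordinal mj)) //= subrr !mul0r.
Qed.


Section Weights.
Variables (F : numFieldType) (V : voa F).

Lemma weight_subspace n : subspace (weight V n).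
Proof. by have [s ->] := weight_fin_dim V n; apply: subspace_lspan. Qed.

Lemma homogeneous_sum (H : nat -> set V) :
  (forall i, subspace (H i)) ->
  forall v, lspan [set x | exists i, H i x] v ->
  exists N f, [/\ forall i, H i (f i), forall i, (N <= i)%N -> f i = 0 &
                  v = \sum_(i < N) f i].
Proof.
move=> sH; apply: lspan_min.
  split.
    exists 0%N, (fun=> 0); split=> //; last by rewrite big_ord0.
    by move=> i; case: (sH i).
  move=> c _ _ [N [f [Hf f0 ->]]] [M [g [Hg g0 ->]]].
  exists (maxn N M), (fun i => c *: f i + g i); split.
  - by move=> i; case: (sH i) => _; apply.
  - by move=> i; rewrite geq_max => /andP[/f0-> /g0->]; rewrite scaler0 addr0.
  have widen (K L : nat) (h : nat -> V) : (K <= L)%N ->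
      (forall i, (K <= i)%N -> h i = 0) ->
      \sum_(i < K) h i = \sum_(i < L) h i.
    move=> KL h0; rewrite -!(big_mkord xpredT) [RHS](@big_cat_nat _ _ _ K) //=.
    rewrite [X in _ + X]big_nat_cond [X in _ + X]big1 ?addr0 //.
    by move=> i /andP[/andP[/h0]].
  rewrite (widen _ (maxn N M) f) ?leq_maxl //.
  rewrite (widen _ (maxn N M) g) ?leq_maxr //.
  by rewrite big_split scaler_sumr.
move=> x [i Hx]; exists i.+1, (fun j => if j == i then x else 0); split.
- by move=> j; case: eqP => [->//|_]; case: (sH j).
- by move=> j ij; rewrite gtn_eqF.
rewrite big_ord_recr /= eqxx big1 ?add0r // => j _.
by rewrite ltn_eqF.
Qed.

(** Directness of the weight grading: if a subspace is the sum of its pieces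
H i, the component of weight n of one of its elements lies in H n. It serves to
make the decomposition V = C_2(V) + <A> weight by weight. *)
Lemma homogeneous_part (H : nat -> set V) :
  (forall i, subspace (H i)) -> (forall i, H i `<=` weight V i) ->
  forall n v, lspan [set x | exists i, H i x] v -> weight V n v -> H n v.
Proof.
move=> sH Hw n v /(homogeneous_sum sH)[N [f [Hf f0 ->]]] wv.
(* the difference of two decompositions of the same vector *)
pose g i := f i - (if i == n then \sum_(j < N) f j else 0).
have wg i : weight V i (g i).
  apply: subspaceB; [exact: weight_subspace|exact/Hw/Hf|].
  by case: eqP => [->//|_]; case: (weight_subspace i).
have sg : \sum_(i < maxn N n.+1) g i = 0.
  rewrite /g sumrB; apply/eqP; rewrite subr_eq0; apply/eqP.
  have nM : (n < maxn N n.+1)%N by rewrite leq_max ltnSn orbT.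
  rewrite [RHS](bigD1 (Ordinal nM)) //= eqxx [X in _ + X]big1; last first.
    by move=> i; rewrite -val_eqE /= => /negbTE->.
  rewrite addr0 -!(big_mkord xpredT).
  rewrite [LHS](@big_cat_nat _ _ _ N) ?leq_maxl //=.
  rewrite [X in _ + X]big_nat_cond [X in _ + X]big1 ?addr0 //.
  by move=> i /andP[/andP[/f0]].
have := weight_direct wg sg (i := n); rewrite leq_max ltnSn orbT => /(_ isT).
rewrite /g eqxx => /eqP; rewrite subr_eq0 => /eqP <-; exact: Hf.
Qed.

Lemma lspan_homogeneous (v : V) : lspan [set x | exists i, weight V i x] v.
Proof.
have [n [f [wf ->]]] := weight_sum v; apply: subspace_sum => [|i _].
  exact: subspace_lspan.
by apply: lspan_gen; exists i.
Qed.

(** L(0) acts on V_n by n, so in characteristic 0 it separates the weights;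
an eigenvalue that is not a natural number occurs only on the zero vector. *)
Lemma L0_eigenvector (m : int) (x : V) :
  mode V (conformal V) 1 x = m%:~R *: x ->
  if m is Posz c then weight V c x else x = 0.
Proof.
have [N [f [wf ->]]] := weight_sum x; rewrite linear_sum scaler_sumr => e.
have z i : (i < N)%N -> i%:Z != m -> f i = 0.
  move=> iN im; pose g i := (i%:R - m%:~R : F) *: f i.
  have : g i = 0.
    apply: (@weight_direct _ V N g) => //.
      by move=> j; apply: subspaceZ => //; apply: weight_subspace.
    rewrite /g; under eq_bigr do rewrite scalerBl.
    rewrite sumrB -e; apply/eqP; rewrite subr_eq0; apply/eqP.
    by apply: eq_bigr => j _; rewrite (L0_weight (wf j)).
  move/eqP; rewrite /g scaler_eq0 => /orP[|/eqP//].
  by rewrite pmulrn -intrB intr_eq0 subr_eq0 (negbTE im).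
case: m {e} z => c z; last by rewrite big1 // => i _; apply: z.
apply: subspace_sum => [|i _]; first exact: weight_subspace.
have [<-//|ic] := eqVneq (i : nat) c.
by rewrite z //; case: (weight_subspace c).
Qed.

(** The component form of the Jacobi identity at (p, q, r) = (1, n, 0) is the
commutator [L(0), u(n)] = (L(-1)u)(n+1) + (L(0)u)(n), and the first term equals
-(n+1) u(n), so u(n)v is an eigenvector of L(0). *)
Lemma mode_weight (a b : nat) (u v : V) (n : int) :
  weight V a u -> weight V b v ->
  if a%:Z + b%:Z - n - 1 is Posz c then weight V c (mode V u n v)
  else mode V u n v = 0.
Proof.
move=> wu wv; apply: L0_eigenvector.
have [s [/sums_to_trunc hs /sums_to_trunc ht]] :=
  jacobi 1 n 0 (conformal V) u v.
have {}hs : s =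
    mode V (mode V (conformal V) 0 u) (n + 1) v + a%:R *: mode V u n v.
  rewrite (hs 2%N) => [|j j2]; last by rewrite (@binz_small F 1) ?scale0r.
  rewrite 2!big_ord_recl big_ord0 addr0 /=.
  rewrite /binz big_ord0 big_ord_recl big_ord0 /= !subr0 !mulr1.
  rewrite !add0r !divr1 !scale1r (L0_weight wu).
  rewrite (linear_scale (f := fun x => mode V x _ v)) //.
    by rewrite addr0 [1 + n]addrC addrK.
  exact: mode_linear.
have {}ht : s = mode V (conformal V) 1 (mode V u n v) - b%:R *: mode V u n v.
  rewrite (ht 1%N) => [|j j1].
    2: by rewrite (@binz_small F 0) ?mulr0 ?scale0r.
  rewrite big_ord_recl big_ord0 addr0 /= /binz big_ord0 divr1 mulr1.
  by rewrite !addr0 expr0z !scale1r (L0_weight wv) linearZ.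
move: hs; rewrite ht => /eqP; rewrite subr_eq => /eqP->.
rewrite mode_derivative addrK -scaleNr -!scalerDl; congr (_ *: _).
by rewrite !intrD !intrN !pmulrn; ring.
Qed.

End Weights.

(** * Homogeneous generators modulo C_2 *)

Definition C2_generated (F : fieldType) (V : voa F) (A : seq V) : Prop :=
  forall v : V, exists a b : V, [/\ C2 V a, lspan [set` A] b & v = a + b].

(** Only finitely many vectors are needed to span V modulo C_2(V), and each of
them involves finitely many elements of A. *)
Lemma C2_generated_finite (F : fieldType) (V : voa F) (A : set V) :
  C2_cofinite V ->
  (forall v : V, exists a b : V, C2 V a /\ lspan A b /\ v = a + b) ->
  exists2 B : seq V, (forall v, v \in B -> A v) & C2_generated B.
Proof.
move=> [t ht] hA.
have [B BA hB] : exists2 B : seq V, (forall v, v \in B -> A v) &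
    forall v, v \in t -> exists a b : V,
      [/\ C2 V a, lspan [set` B] b & v = a + b].
  elim: t {ht} => [|v t [B BA hB]]; first by exists [::].
  have [a [b [Ca [[s hs eb] ev]]]] := hA v.
  exists ([seq p.2 | p <- s] ++ B) => [x|x].
    by rewrite mem_cat => /orP[/mapP[p /hs Ap ->]//|/BA].
  rewrite inE => /predU1P[->|/hB[a' [b' [Ca' Bb' ->]]]].
    exists a, b; split=> //; exists s => // p ps.
    by rewrite /= mem_cat map_f.
  exists a', b'; split=> //; apply: lspan_mono Bb' => y /= yB.
  by rewrite mem_cat yB orbT.
exists B => // v.
pose U := [set v | exists a b : V, [/\ C2 V a, lspan [set` B] b & v = a + b]].
have sC : subspace (C2 V) := subspace_lspan _.
have sB : subspace (lspan [set` B]) := subspace_lspan _.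
have sU : subspace U.
  split; first by exists 0, 0; split; [case: sC|case: sB|rewrite addr0].
  move=> c _ _ [a [b [Ca Bb ->]]] [a' [b' [Ca' Bb' ->]]].
  exists (c *: a + a'), (c *: b + b'); split.
  - by case: sC => _; apply.
  - by case: sB => _; apply.
  by rewrite scalerDr addrACA.
have [x tx Cvx] := ht v.
have -> : v = x + (v - x) by rewrite addrC subrK.
apply: (subspaceD sU); first by apply: (lspan_min sU _ tx) => y /= /hB.
exists (v - x), 0; split=> //; first by case: sB.
by rewrite addr0.
Qed.

Section Generators.
Variables (F : numFieldType) (V : voa F).

Definition weight_generators (A : seq V) (n : nat) : set V :=
  [set x | x \in A /\ weight V n x] `|`
  [set x | exists a b na nb, [/\ weight V na a, weight V nb b,
    n = (na + nb).+1 & x = mode V a (-2) b]].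

Lemma weight_mode2 a b na nb : weight V na a -> weight V nb b ->
  weight V (na + nb).+1 (mode V a (-2) b).
Proof.
move=> wa wb; have := mode_weight (-2) wa wb.
by have -> : na%:Z + nb%:Z - (-2) - 1 = (na + nb).+1%:Z by lia.
Qed.

(** The given decomposition of a homogeneous v into C_2(V) and <A> need not be
homogeneous; since both summands are spanned by homogeneous vectors, it can be
replaced by its component of weight n. *)
Lemma lspan_weight_generators (A : seq V) :
  (forall v, v \in A -> homogeneous V v) -> C2_generated A ->
  forall n v, weight V n v -> lspan (weight_generators A n) v.
Proof.
move=> hA gA n v wv.
apply: (@homogeneous_part _ _ (fun n => lspan (weight_generators A n))) wv.
- by move=> i; apply: subspace_lspan.
- move=> i; apply: lspan_min; first exact: weight_subspace.
  by move=> x [[]//|[a [b [na [nb [wa wb -> ->]]]]]]; apply: weight_mode2.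
set U := lspan _; have sU : subspace U := subspace_lspan _.
have [c2 [b [Cc Ab ->]]] := gA v.
apply: subspaceD => //; last first.
  apply: (lspan_min sU _ Ab) => x /= xA; have [i wx] := hA x xA.
  by apply: lspan_gen; exists i; apply: lspan_gen; left.
apply: (lspan_min sU _ Cc) => _ [a [d ->]].
apply: (lspan_linear (f := fun x => mode V x (-2) d) (mode_linear (-2) d) sU _
  (lspan_homogeneous a)) => {}a [na wa].
apply: (lspan_linear (f := mode V a (-2)) _ sU _ (lspan_homogeneous d)).
  by move=> k x y; rewrite linearP.
move=> {}d [nd wd]; apply: lspan_gen; exists (na + nd).+1; apply: lspan_gen.
by right; exists a, d, na, nd.
Qed.

End Generators.

(** * Words of modes *)

(** A word is to be permuted by exchanging neighbours, since this is what the
commutator formula controls. *)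
Lemma swap_perm_ind (T : eqType) (P : seq T -> Prop) :
  (forall s1 x y s2, P (s1 ++ x :: y :: s2) -> P (s1 ++ y :: x :: s2)) ->
  forall s s', perm_eq s s' -> P s -> P s'.
Proof.
move=> swap s s'; apply: catCA_perm_ind => s1 s2 s3.
have move1 p t x r : P (p ++ t ++ x :: r) -> P (p ++ x :: t ++ r).
  elim: t p => [//|y t IH] p /=.
  by rewrite -cat_rcons => /IH; rewrite cat_rcons; apply: swap.
suff block p : P (p ++ s1 ++ s2 ++ s3) -> P (p ++ s2 ++ s1 ++ s3).
  exact: (block [::]).
elim: s2 p => [//|x s2 IH] p /= /move1.
by rewrite -!cat_rcons; apply: IH.
Qed.

Section Words.
Variables (F : numFieldType) (V : voa F) (W : weak_module V) (w : W).

(** The letter (v, n, i) stands for the mode v(i) of a vector v of weight n.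
The weight is recorded because the zero vector has every weight. *)
Definition letter := (V * nat * int)%type.
Implicit Types (s t : seq letter) (l : letter) (T : int -> set W).

Definition word_action s (x : W) : W :=
  monomial [seq (l.1.1, l.2) | l <- s] x.

Definition graded s : Prop := forall l, l \in s -> weight V l.1.2 l.1.1.

Definition total_weight s : nat := \sum_(l <- s) l.1.2.

Definition degree s : int := \sum_(l <- s) (l.1.2%:Z - l.2 - 1).

Lemma word_action_cat s t x :
  word_action (s ++ t) x = word_action s (word_action t x).
Proof. by rewrite /word_action map_cat /monomial foldr_cat. Qed.

Lemma word_action_sum s (I : Type) (r : seq I) (f : I -> W) :
  word_action s (\sum_(i <- r) f i) = \sum_(i <- r) word_action s (f i).
Proof.
elim: s => //= l s IH.
by rewrite /word_action /= -/(word_action _ _) IH linear_sum.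
Qed.

Lemma word_actionZ s c x : word_action s (c *: x) = c *: word_action s x.
Proof.
elim: s => //= l s IH.
by rewrite /word_action /= -/(word_action _ _) IH linearZ.
Qed.

Lemma word_actionB s x y :
  word_action s (x - y) = word_action s x - word_action s y.
Proof.
elim: s => //= l s IH.
by rewrite /word_action /= -/(word_action _ _) IH linearB.
Qed.

Lemma word_action0 s : word_action s 0 = 0.
Proof. by have := word_actionZ s 0 0; rewrite !scale0r. Qed.

Lemma degree_cat s t : degree (s ++ t) = degree s + degree t.
Proof. by rewrite /degree big_cat. Qed.

Lemma degree_cons l s : degree (l :: s) = l.1.2%:Z - l.2 - 1 + degree s.
Proof. by rewrite /degree big_cons. Qed.

Lemma total_weight_cat s t :
  total_weight (s ++ t) = (total_weight s + total_weight t)%N.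
Proof. by rewrite /total_weight big_cat. Qed.

Lemma total_weight_cons l s :
  total_weight (l :: s) = (l.1.2 + total_weight s)%N.
Proof. by rewrite /total_weight big_cons. Qed.

Lemma graded_cons l s : graded (l :: s) <-> weight V l.1.2 l.1.1 /\ graded s.
Proof.
split=> [g|[gl gs] k]; last by rewrite inE => /predU1P[->|/gs].
by split=> [|k ks]; apply: g; rewrite inE ?eqxx ?ks ?orbT.
Qed.

Lemma graded_cat s t : graded (s ++ t) <-> graded s /\ graded t.
Proof.
split=> [g|[gs gt] k]; last by rewrite mem_cat => /orP[/gs|/gt].
by split=> k ks; apply: g; rewrite mem_cat ks ?orbT.
Qed.

(** T d is the subspace of degree d into which words are to be rewritten. *)
Definition reduces T s : Prop := T (degree s) (word_action s w).

Definition reduces_below T n : Prop :=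
  forall s, graded s -> (total_weight s < n)%N -> reduces T s.

Section LowerWeight.
Variables (T : int -> set W) (n : nat).
Hypothesis sT : forall d, subspace (T d).
Hypothesis lowT : reduces_below T n.

(** Terms of the commutator formula have this shape. The inequality says that
they have lower total weight; it is stated in the integers because
wt(u) + wt(v) - k - 1 may be negative, and then u(k)v = 0. *)
Lemma reduces_product s1 s2 (u v : V) (a b : nat) (k m : int) d :
  graded s1 -> graded s2 -> weight V a u -> weight V b v ->
  (total_weight s1 + total_weight s2)%:Z + (a%:Z + b%:Z - k - 1) < n%:Z ->
  d = degree s1 + (a%:Z + b%:Z - k - m - 2) + degree s2 ->
  T d (word_action s1 (act W (mode V u k v) m (word_action s2 w))).
Proof.
move=> g1 g2 wu wv; have := mode_weight k wu wv.
case E: (_ - 1) => [c|c] => [wc lt ->|-> _ _]; last first.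
  have -> : act W 0 m (word_action s2 w) = 0.
    have := linear_scale 0 0 (act_linear (w := W) m (word_action s2 w)).
    by rewrite !scale0r.
  by rewrite word_action0; case: (sT d).
have := @lowT (s1 ++ (mode V u k v, c, m) :: s2).
rewrite /reduces word_action_cat degree_cat degree_cons /=.
have -> : degree s1 + (c%:Z - m - 1 + degree s2) =
  degree s1 + (a%:Z + b%:Z - k - m - 2) + degree s2.
  rewrite (_ : c%:Z = a%:Z + b%:Z - k - 1) //; ring.
apply.
  by apply/graded_cat; split=> //; apply/graded_cons.
rewrite total_weight_cat total_weight_cons /=; lia.
Qed.

(** The j-th term of [u(m), v(n)] contains u(j)v with j >= 0, whose weight is
smaller than wt(u) + wt(v). *)
Lemma reduces_swap s1 l1 l2 s2 :
  graded (s1 ++ l1 :: l2 :: s2) ->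
  (total_weight (s1 ++ l1 :: l2 :: s2) <= n)%N ->
  reduces T (s1 ++ l1 :: l2 :: s2) -> reduces T (s1 ++ l2 :: l1 :: s2).
Proof.
case: l1 => [[u a] i]; case: l2 => [[v b] j].
move=> /graded_cat[g1 /graded_cons[/= wu /graded_cons[/= wv g2]]].
rewrite total_weight_cat !total_weight_cons /reduces.
rewrite !degree_cat !degree_cons /=.
rewrite !word_action_cat {2 4}/word_action /= -/(word_action _ _) => lt.
set d := degree _ + _; set d' := degree _ + _.
have <- : d = d' by rewrite /d /d'; ring.
set y := word_action s2 w => Tuv.
rewrite -[X in T _ X](subKr (word_action s1 (act W u i (act W v j y)))).
apply: subspaceB => //; rewrite -word_actionB.
have [N /(_ N (leqnn N)) <-] := act_commutator u v i j y.
rewrite word_action_sum; apply: subspace_sum => // k _.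
rewrite word_actionZ; apply: subspaceZ => //.
apply: (reduces_product g1 g2 wu wv); first lia.
by rewrite /d; ring.
Qed.

Lemma reduces_perm s t : perm_eq s t -> graded s -> (total_weight s <= n)%N ->
  reduces T s -> reduces T t.
Proof.
move=> st gs ws rs.
have : [/\ graded t, (total_weight t <= n)%N & reduces T t]; last by case.
apply: (swap_perm_ind (P := fun t => [/\ graded t, (total_weight t <= n)%N &
  reduces T t]) _ st) => // s1 x y s2 [g wt r].
have p : perm_eq (s1 ++ x :: y :: s2) (s1 ++ y :: x :: s2).
  by rewrite perm_cat2l (perm_catCA [:: x] [:: y] s2).
split; last exact: reduces_swap.
  by move=> l; rewrite -(perm_mem p); apply: g.
by rewrite /total_weight -(perm_big _ p).
Qed.

(** The vector a(-2)b has weight wt(a) + wt(b) + 1, while every term of its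
associativity expansion is a product of one mode of a and one mode of b. *)
Lemma reduces_C2 s (a b : V) (na nb : nat) (i : int) :
  graded s -> weight V na a -> weight V nb b ->
  (na + nb + total_weight s < n)%N ->
  reduces T ((mode V a (-2) b, (na + nb).+1, i) :: s).
Proof.
move=> gs wa wb lt; rewrite /reduces /word_action /= -/(word_action _ _).
have [N /(_ N (leqnn N)) <-] := act_associativity a b (-2) i (word_action s w).
have pair (u v : V) (nu nv : nat) (p q : int) :
    weight V nu u -> weight V nv v -> (nu + nv + total_weight s < n)%N ->
    degree ((mode V a (-2) b, (na + nb).+1, i) :: s) =
      nu%:Z - p - 1 + (nv%:Z - q - 1 + degree s) ->
    T (degree ((mode V a (-2) b, (na + nb).+1, i) :: s))
      (act W u p (act W v q (word_action s w))).
  move=> wu wv l ->; have := @lowT ((u, nu, p) :: (v, nv, q) :: s).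
  rewrite /reduces !degree_cons !total_weight_cons; apply.
    by apply/graded_cons; split=> //; apply/graded_cons.
  by rewrite addnA.
apply: subspace_sum => // j _; apply: subspaceZ => //; apply: subspaceB => //.
  by apply: (pair a b na nb) => //; rewrite degree_cons /=; lia.
apply: subspaceZ => //; apply: (pair b a nb na) => //.
  by rewrite [(nb + _)%N]addnC.
by rewrite degree_cons /=; lia.
Qed.

End LowerWeight.
End Words.

(** * Separating repeated modes *)

(** In the expansion of (u(-1)v)(2m+1) the two modes add up to 2m. The term of
index j contributes u(-1-j)v(2m+1+j) and v(2m-j)u(j), so equal modes occur in
exactly one index, as v(m)u(m) if m >= 0 and as u(m)v(m) if m < 0, with a
nonzero coefficient. *)
Lemma repeated_mode (F : numFieldType) (V : voa F) (W : weak_module V)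
    (U : set W) (u v : V) (m : int) (y : W) :
  subspace U -> U (act W (mode V u (-1) v) (m + m + 1) y) ->
  (forall a b : int, a + b = m + m -> a != m ->
    U (act W u a (act W v b y)) /\ U (act W v a (act W u b y))) ->
  (U (act W v m (act W u m y)) -> U (act W u m (act W v m y))) ->
  U (act W u m (act W v m y)).
Proof.
move=> sU Uuv other swap.
have [k mk] : exists k : nat, m = k%:Z \/ m = - 1 - k%:Z.
  by case: (m) => k; exists k; [left|right; rewrite NegzE; lia].
have [N /(_ (maxn N k.+1) (leq_maxl _ _)) e] :=
  act_associativity u v (-1) (m + m + 1) y.
have kN : (k < maxn N k.+1)%N by rewrite leq_max ltnSn orbT.
move: Uuv; rewrite -e (bigD1 (Ordinal kN)) //=; set rest := \sum_(i < _ | _) _.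
have Urest : U rest.
  apply: subspace_sum => // j; rewrite -val_eqE /= => jk.
  apply: subspaceZ => //; apply: subspaceB => //.
    by apply: (other _ _ _ _).1; lia.
  by apply: subspaceZ => //; apply: (other _ _ _ _).2; lia.
move=> /(subspaceB sU)/(_ Urest); rewrite addrK.
move=> /(subspaceZ_inv sU)/=; set c := _ * _.
have c0 : c != 0.
  rewrite mulf_neq0 ?signr_eq0 // mulf_neq0 //.
    2: by rewrite invr_eq0 pnatr_eq0 -lt0n fact_gt0.
  by apply/prodf_neq0 => i _; rewrite intr_eq0; lia.
move=> /(_ c0); case: mk => mk.
  have -> : -1 + (m + m + 1) - k%:Z = m by lia.
  rewrite -{3}mk => h; apply: swap.
  have [|//|o _] := other (-1 - k%:Z) (m + m + 1 + k%:Z); [lia..|].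
  have := subspaceB sU o h; rewrite subKr => /(subspaceZ_inv sU); apply.
  by rewrite expfz_neq0 // oppr_eq0 oner_eq0.
have -> : m + m + 1 + k%:Z = m by lia.
rewrite -{1}mk => h.
have [|//|_ o] := other (-1 + (m + m + 1) - k%:Z) k%:Z; [lia..|].
by have := subspaceD sU h (subspaceZ ((-1) ^ (-1)) sU o); rewrite subrK.
Qed.

Lemma perm_repeat (T T' : eqType) (f : T -> T') (s : seq T) :
  ~~ uniq (map f s) ->
  exists x y t, perm_eq s (x :: y :: t) /\ f x = f y.
Proof.
elim: s => //= x s IH; rewrite negb_and negbK => /orP[/mapP[y ys xy]|/IH].
  by exists x, y, (rem y s); rewrite perm_cons perm_to_rem.
move=> [y [z [t [p e]]]]; exists y, z, (x :: t); split=> //.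
have: perm_eq (x :: s) (x :: y :: z :: t) by rewrite perm_cons.
move=> /perm_trans; apply.
by rewrite -(perm_catCA [:: y; z] [:: x] t).
Qed.

(** * The spanning set *)

Section Spanning.
Variables (F : numFieldType) (V : voa F) (W : weak_module V) (w : W).
Variables (A : seq V) (N : nat).
Hypothesis hA : forall v, v \in A -> homogeneous V v.
Hypothesis gA : C2_generated A.
Hypothesis hN : forall v (i : int), v \in A -> N%:Z < i -> act W v i w = 0.
Implicit Types (s t : seq (letter V)) (l : letter V).

Definition over s : bool := all (fun l => l.1.1 \in A) s.

Definition normal_word s : Prop :=
  [/\ graded s, over s, sorted <%R [seq l.2 | l <- s] &
      all (fun l => l.2 <= N%:Z) s].

Definition normal_span (d : int) : set W :=
  lspan [set x | exists s,
    [/\ normal_word s, degree s = d & x = word_action s w]].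

Let T := normal_span.
Let sT d : subspace (T d). Proof. exact: subspace_lspan. Qed.

(** A letter v outside A is a combination of elements of A of the same weight
and of vectors a(-2)b, which lower the total weight. The letters are replaced
one after the other: the word is split as s ++ t with t already over A, and
the new letter is moved behind s. *)
Lemma reduces_to_over n k :
  reduces_below w T n ->
  (forall s, graded s -> (total_weight s <= n)%N -> size s = k -> over s ->
     reduces w T s) ->
  forall s, graded s -> (total_weight s <= n)%N -> size s = k -> reduces w T s.
Proof.
move=> low red s; rewrite -[s]cats0; have: over [::] by [].
elim: s [::] => [|[[v a] i] s IH] t ot g wt sz; first exact: red.
move: g; rewrite cat_cons => /graded_cons[/= wv gst].
rewrite cat_cons total_weight_cons /= in wt.
rewrite /reduces degree_cons /word_action /= -/(word_action _ _).
apply: (lspan_linear (act_linear (w := W) i (word_action (s ++ t) w)) (sT _) _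
  (lspan_weight_generators hA gA wv)) => x [[xA wx]|].
  have : reduces w T ((x, a, i) :: s ++ t); first last.
    by rewrite /reduces degree_cons.
  have p : perm_eq (s ++ (x, a, i) :: t) ((x, a, i) :: s ++ t).
    by rewrite -(cat1s _ t) perm_catCA.
  have g' : graded (s ++ (x, a, i) :: t).
    by move=> l; rewrite (perm_mem p); move: l; apply/graded_cons.
  have wt' : (total_weight (s ++ (x, a, i) :: t) <= n)%N.
    rewrite /total_weight (perm_big _ p) /= -/(total_weight _).
    by rewrite total_weight_cons.
  apply: (reduces_perm sT low p) => //; apply: IH => //.
    by rewrite /= xA.
  by rewrite (perm_size p).
move=> [b [c [nb [nc [wb wc ea ->]]]]].
have := @reduces_C2 _ _ _ w T n sT low (s ++ t) b c nb nc i gst wb wc.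
by rewrite /reduces degree_cons -ea; apply; rewrite ea in wt.
Qed.

(** Replacing two modes i, i by i + t, i - t adds 2 t^2 to the spread and leaves
the depth unchanged. *)
Definition spread s : int := \sum_(l <- s) (N%:Z - l.2) ^+ 2.
Definition depth s : int := \sum_(l <- s) (N%:Z - l.2).

(** The squares of nonnegative numbers add up to at most the square of their
sum; this bounds how far modes below N with a given sum can be spread. *)
Lemma spread_le_depth2 s : all (fun l => l.2 <= N%:Z) s ->
  0 <= depth s /\ spread s <= depth s ^+ 2.
Proof.
elim: s => [|l s IH] /=; first by rewrite /spread /depth !big_nil.
case/andP=> lN /IH[]; rewrite /spread /depth !big_cons.
rewrite -subr_ge0 in lN; move: lN.
move: (N%:Z - l.2) (\sum_(l <- s) _) (\sum_(l <- s) _) => x D S x0 D0 SD.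
split; first exact: addr_ge0.
by rewrite sqrrD addrAC -[leLHS]addr0 !lerD // mulrn_wge0 // mulr_ge0.
Qed.

(** Induction on the room depth^2 - spread left for spreading, for words over A
of fixed length k; shorter words arise from (u(-1)v)(2m+1). *)
Lemma reduces_over n k M :
  reduces_below w T n ->
  (forall s, graded s -> (total_weight s <= n)%N -> (size s < k)%N ->
     reduces w T s) ->
  forall s, graded s -> (total_weight s <= n)%N -> size s = k -> over s ->
    depth s ^+ 2 - spread s < M%:Z -> reduces w T s.
Proof.
move=> low short; elim: M => [|M IH] s gs wt sz os mu.
all: have perm t : perm_eq t s -> reduces w T t -> reduces w T s.
all: try by move=> p; apply: (reduces_perm sT low p);
  [move=> l; rewrite (perm_mem p); apply: gs
  |rewrite /total_weight (perm_big _ p)].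
all: have [/hasP[l ls lN]|] := boolP (has (fun l => N%:Z < l.2) s).
(* A mode above N is moved to the right end, where it kills w. *)
1,3: apply: (perm (rem l s ++ [:: l]));
  first by rewrite perm_sym (perm_trans (perm_to_rem ls)) // perm_sym perm_catC.
1,2: by rewrite /reduces word_action_cat /word_action /= hN ?(allP os) //
  -/(word_action _ _) word_action0; case: (sT (degree (rem l s ++ [:: l]))).
all: rewrite -all_predC => sN.
all: have {}sN : all (fun l => l.2 <= N%:Z) s by
  apply: sub_all sN => l /=; rewrite -leNgt.
  by have [_] := spread_le_depth2 sN; move: mu; lia.
(* All modes are at most N: either they are distinct, and the word can be
   sorted, or two letters with the same mode are brought to the front. *)
have [us|/perm_repeat[[[u a] i] [[[v b] j] [t [p /= ij]]]]] :=
  boolP (uniq [seq l.2 | l <- s]).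
  pose t := sort (relpre (fun l => l.2) <=%R) s.
  have p : perm_eq t s by rewrite perm_sort.
  apply: (perm t p); apply: lspan_gen; exists t; split=> //; split.
  - by move=> l; rewrite (perm_mem p); apply: gs.
  - by rewrite /over (perm_all _ p).
  - rewrite lt_sorted_uniq_le (perm_uniq (perm_map _ p)) us /= sorted_map.
    by apply: sort_sorted => x y; apply: le_total.
  by rewrite (perm_all _ p).
subst j; apply: (perm _ _); first by rewrite perm_sym; exact: p.
have gt : graded ((u, a, i) :: (v, b, i) :: t).
  by move=> l; rewrite -(perm_mem p); apply: gs.
have [/= wu /graded_cons[/= wv {}gt]] := (graded_cons _ _).1 gt.
move: wt sz os mu; rewrite /total_weight /over /depth /spread.
rewrite !(perm_big _ p) (perm_size p) (perm_all _ p) !big_cons /=.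
rewrite -/(total_weight t) -/(depth t) -/(spread t).
move=> wt sz /and3P[uA vA ot] mu.
rewrite /reduces !degree_cons /word_action /= -/(word_action _ _).
set d := _ + _; set y := word_action t w.
(* The unequal modes are further apart than i, i. *)
have red (u' v' : V) a' b' (i' j' : int) : u' \in A -> v' \in A ->
    weight V a' u' -> weight V b' v' -> (a' + b' = a + b)%N ->
    i' + j' = i + i -> i' != i -> T d (act W u' i' (act W v' j' y)).
  move=> uA' vA' wu' wv' ab ij ii.
  have := IH ((u', a', i') :: (v', b', j') :: t).
  rewrite /reduces !degree_cons /=.
  have -> : a'%:Z - i' - 1 + (b'%:Z - j' - 1 + degree t) = d.
    by rewrite /d /=; lia.
  apply.
  - by apply/graded_cons; split=> //; apply/graded_cons.
  - by rewrite !total_weight_cons /=; lia.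
  - by [].
  - by rewrite /= uA' vA'.
  rewrite /depth /spread !big_cons /= -/(depth t) -/(spread t).
  have -> : j' = i + i - i' by rewrite -ij addrC addKr.
  nia.
apply: repeated_mode => //.
- have := short ((mode V u (-1) v, (a + b)%N, i + i + 1) :: t).
  rewrite /reduces degree_cons /=.
  have -> : (a + b)%N%:Z - (i + i + 1) - 1 + degree t = d.
    by rewrite /d /=; lia.
  apply.
  + apply/graded_cons; split=> //=; have := mode_weight (-1) wu wv.
    by have -> : a%:Z + b%:Z - (-1) - 1 = (a + b)%N%:Z by lia.
  + by rewrite total_weight_cons /=; lia.
  by rewrite -sz.
- by move=> i' j' e ne; split; [apply: (red u v a b)|apply: (red v u b a)];
    rewrite // addnC.
have := @reduces_swap _ _ _ w T n sT low [::] (v, b, i) (u, a, i) t.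
rewrite /reduces !cat0s !degree_cons !total_weight_cons /=.
have -> : b%:Z - i - 1 + (a%:Z - i - 1 + degree t) = d.
  by rewrite /d /=; lia.
apply; last by lia.
by apply/graded_cons; split=> //; apply/graded_cons.
Qed.

Lemma reduces_graded s : graded s -> reduces w T s.
Proof.
have [n] := ubnP (total_weight s).
elim: n s => [//|n low] s wt gs; rewrite ltnS in wt.
have {}low : reduces_below w T n by move=> t gt /low; apply.
have [k] := ubnP (size s).
elim: k s wt gs => [//|k short] s wt gs; rewrite ltnS => sz.
apply: (reduces_to_over low _ gs wt (erefl _)) => t gt wt' et ot.
apply: (reduces_over (M := `|depth t ^+ 2 - spread t|%N.+1) low _ gt wt' et ot).
  by move=> r gr wr szr; apply: short => //; apply: leq_trans szr sz.
lia.
Qed.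

(** A letter (v, n, i) has degree n - i - 1 >= -(i + 1), which is negative only
if 0 <= i <= N; as the modes are distinct there are at most N + 1 such letters,
and each contributes at least -(N + 1). *)
Lemma normal_degree_ge s : normal_word s -> - (N.+1 ^ 2)%N%:Z <= degree s.
Proof.
move=> [_ _ so sN].
have le : - (\sum_(l <- s | (0 <= l.2)%R) N.+1)%N%:Z <= degree s.
  rewrite /degree; elim: s sN {so} => [|l s IH] /=; first by rewrite !big_nil.
  case/andP=> lN /IH; rewrite !big_cons.
  move: (\sum_(i <- s | _) _)%N (\sum_(i <- s) _) => C D.
  by case: ifP lN; lia.
apply: le_trans le; rewrite lerN2 lez_nat.
rewrite big_const_seq iter_addn_0 expnS expn1 leq_mul2l /=.
pose r := [seq `|i|%N | i <- [seq l.2 | l <- s] & 0 <= i].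
have -> : count (fun l => 0 <= l.2) s = size r.
  by rewrite size_map size_filter count_map.
rewrite -[leqRHS](size_iota 0); apply: uniq_leq_size.
  rewrite map_inj_in_uniq ?filter_uniq ?(lt_sorted_uniq so) //.
  by move=> i j; rewrite !mem_filter => /andP[i0 _] /andP[j0 _]; lia.
move=> x xr; have [i + ->] := mapP xr; rewrite mem_filter => /andP[i0 il].
have [l ls il2] := mapP il; rewrite il2 in i0 *.
by rewrite mem_iota; have := allP sN l ls; lia.
Qed.

Lemma normal_span_eq0 d : d < - (N.+1 ^ 2)%N%:Z -> normal_span d `<=` [set 0].
Proof.
move=> dN; apply: lspan_min; first exact: subspace_set1_0.
by move=> x [s [/normal_degree_ge + sd _]]; rewrite sd leNgt dN.
Qed.

End Spanning.

Lemma graded_span (F : numFieldType) (V : voa F) (W : weak_module V) (w : W) :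
  generated_by w ->
  lspan [set x | exists2 s, graded s & x = word_action s w] = [set: W].
Proof.
move=> gw; set U := lspan _; have sU : subspace U := subspace_lspan _.
apply: gw => [|v n x|].
- split; first by rewrite inE; case: sU.
  by move=> c x y; rewrite !inE; case: sU => _; apply.
- apply: (lspan_linear (f := act W v n)) => // [c y z|_ [s gs ->]].
    by rewrite linearP.
  apply: (lspan_linear (act_linear n (word_action s w)) sU _
    (lspan_homogeneous v)) => u [k wu].
  apply: lspan_gen; exists ((u, k, n) :: s) => //.
  by apply/graded_cons.
by apply: lspan_gen; exists [::].
Qed.

Lemma monomial_degreeP (F : numFieldType) (V : voa F) (s : seq (V * int)) m :
  monomial_degree s m ->
  exists2 t : seq (letter V), graded t &
    degree t = m /\ s = [seq (l.1.1, l.2) | l <- t].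
Proof.
elim=> [|v n i {}s {}m wv _ [t gt [<- ->]]].
  by exists [::] => //; rewrite /degree big_nil.
exists ((v, n, i) :: t); first exact/graded_cons.
by rewrite degree_cons.
Qed.

Lemma finite_truncation (F : fieldType) (V : voa F) (W : weak_module V) (w : W)
    (A : seq V) :
  exists N : nat, forall v (i : int), v \in A -> N%:Z < i -> act W v i w = 0.
Proof.
elim: A => [|a A [N hN]]; first by exists 0%N.
have [M hM] := act_truncation (w := W) a w.
exists (maxn N `|M|) => v i; rewrite inE => /predU1P[->|vA] Ni.
  by apply: hM; lia.
by apply: hN => //; lia.
Qed.

Theorem lemma2p4 (R : realType) (V : voa R[i]) (A : set V)
    (hC2 : C2_cofinite V)
    (hA : A `<=` homogeneous V)
    (hVA : forall v : V, exists a b : V,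
       C2 V a /\ lspan A b /\ v = a + b)
    (W : weak_module V) (w : W) (hw : generated_by w) :
  lspan [set x : W | exists s : seq (V * int),
          (forall p, p \in s -> A p.1) /\
          sorted <%R [seq p.2 | p <- s] /\
          x = monomial s w] = [set: W]
  /\ exists M : int, forall m : int, m < M ->
       degree_space w m = [set 0].
Proof.
have [B BA gB] := C2_generated_finite hC2 hVA.
have hB v : v \in B -> homogeneous V v by move=> /BA /hA.
have [N hN] := finite_truncation w B.
split.
  apply/seteqP; split=> // x _.
  have : [set: W] x by []; rewrite -(graded_span hw).
  apply: lspan_min => [|_ [s gs ->]]; first exact: subspace_lspan.
  apply: lspan_mono (reduces_graded hB gB hN gs) => _ [t [[_ ot st _] _ ->]].
  exists [seq (l.1.1, l.2) | l <- t]; split; last by rewrite -map_comp.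
  by move=> p /mapP[l lt ->]; apply: BA; apply: (allP ot).
exists (- (N.+1 ^ 2)%N%:Z) => m mN; apply/seteqP; split.
  apply: subset_trans (normal_span_eq0 (w := w) (A := B) mN).
  apply: lspan_min => [|x [s /monomial_degreeP[t gt [<- ->]] ->]].
    exact: subspace_lspan.
  exact: (reduces_graded hB gB hN gt).
by move=> _ ->; case: (subspace_lspan
  [set x : W | exists2 s, monomial_degree s m & x = monomial s w]).
Qed.
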